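(* For $D\ge1$ let $\mathbb V(D):=\sup\{|u(0)|^2:\ u\in H^1_{\mathrm{per}}(0,2\pi),\ \int_0^{2\pi}u\,dx=0,\ \|u\|^2=1,\ \|u'\|^2=D\}$. Then for all $D\ge1$, $$\mathbb V(D)<D^{1/2}-\frac1\pi .$$
   Context: Functions are complex-valued and $2\pi$-periodic; $\|\cdot\|$ is the $L_2(0,2\pi)$ norm. *)

(* Defs.v *)
From HB Require Import structures.
From mathcomp Require Import all_boot all_order all_algebra.
From mathcomp Require Import all_classical all_reals all_analysis.
Set Implicit Arguments. Unset Strict Implicit. Unset Printing Implicit Defensive.
Import Order.TTheory GRing.Theory Num.Theory.
Local Open Scope ring_scope.
Local Open Scope classical_set_scope.

(* Complex-valued functions u are represented by their real and imaginary
   parts (a, b) : (R -> R) * (R -> R), i.e. u = a + i b; then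
   |u|^2 = a^2 + b^2, |u'|^2 = a'^2 + b'^2, int u = 0 <-> int a = 0 /\ int b = 0. *)

Definition per_int (R : realType) : set R := `[0, 2 * pi]%classic.
Arguments per_int R : clear implicits.

Definition L2per (R : realType) (g : R -> R) : Prop :=
  measurable_fun (per_int R) g /\
  (@lebesgue_measure R).-integrable (per_int R) (fun x => ((g x) ^+ 2)%:E).

Definition sq_norm (R : realType) (f : R -> R) : R :=
  Rintegral (@lebesgue_measure R) (per_int R) (fun x => (f x) ^+ 2).

Definition mean_int (R : realType) (f : R -> R) : R :=
  Rintegral (@lebesgue_measure R) (per_int R) f.

(* u is a (real-valued) 2pi-periodic H^1 function with weak derivative g:
   u is 2pi-periodic, g in L_2(0,2pi) and u(x) = u(0) + int_0^x g on [0,2pi]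
   (absolutely continuous representative). *)
Definition H1per_deriv (R : realType) (u g : R -> R) : Prop :=
  (forall x : R, u (x + 2 * pi) = u x) /\
  L2per g /\
  (forall x : R, 0 <= x <= 2 * pi ->
     u x = u 0 + Rintegral (@lebesgue_measure R) `[0, x]%classic g).

Definition Vset (R : realType) (D : R) : set R :=
  [set r | exists (a b ga gb : R -> R),
     [/\ H1per_deriv a ga /\ H1per_deriv b gb,
         mean_int a = 0 /\ mean_int b = 0,
         sq_norm a + sq_norm b = 1,
         sq_norm ga + sq_norm gb = D &
         r = a 0 ^+ 2 + b 0 ^+ 2]].

Definition VV (R : realType) (D : R) : R := sup (Vset D).

(* Main.v *)
Require Import Defs.
From mathcomp Require Import all_boot all_order all_algebra.
From mathcomp Require Import all_classical all_reals all_analysis.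
From mathcomp Require Import measurable_realfun ring lra.
Import Order.TTheory GRing.Theory Num.Theory.
Import numFieldNormedType.Exports.
Local Open Scope ring_scope.
Local Open Scope classical_set_scope.

(** Put T = 2 pi.  For a kernel p with p(T) - p(0) = 1 and a constant k,
integration by parts and the zero mean of u give
u(0) = int (u' p + u (p' - k)), whence by Cauchy-Schwarz
|u(0)|^2 <= (||u'||^2 + m^2 ||u||^2) (||p||^2 + ||p' - k||^2 / m^2).
The choice p(x) ~ sinh(m (x - T/2)), k = 1/T, makes the last factor
coth(m pi)/(2 m) - 1/(2 pi m^2), the diagonal value of the periodic Green
function of -d^2/dx^2 + m^2 on zero-mean functions.  Replacing coth by 1, the
resulting bound takes exactly the value sqrt D - 1/pi at m = sqrt D, and it is
increasing in m there; the choice m = sqrt D - 1/pi gains enough to absorb the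
exponentially small error coth(m pi) - 1. *)

Local Notation mu := lebesgue_measure.

(** * Comparison of the constant with sqrt D - 1/pi *)

Lemma expR_ge_series (R : realType) (x : R) (n : nat) :
  0 <= x -> series (exp_coeff x) n <= expR x.
Proof.
move=> x0; apply: nondecreasing_cvgn_le; last exact: is_cvg_series_exp_coeff.
apply: nondecreasing_series => k _ _; exact: exp_coeff_ge0.
Qed.

(* Here p stands for pi and m = z / p = s - 1 / p. *)
Lemma optimal_constant_lt (R : realType) (p s z Q : R) :
  0 < p -> 1 <= z -> s = (z + 1) / p -> Q = expR (z / p * (2 * p)) ->
  ((Q + 1) / (2 * (z / p) * (Q - 1)) - (2 * p * (z / p) ^+ 2)^-1) *
    (s ^+ 2 + (z / p) ^+ 2) < s - p^-1.
Proof.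
move=> p0 z1 -> QE.
have z0 : 0 < z by lra.
(* [Q] is exp(2 z), bounded below by its Taylor polynomial of degree 3. Stopping at degree 2 would
   leave, after multiplication by z + 1, only 2 z^3 against the 4 z^3 in [K]. *)
have E : 2 * z + 2 * z ^+ 2 + 4 / 3 * z ^+ 3 <= Q - 1.
  have := @expR_ge_series R (2 * z) 4 ltac:(lra).
  rewrite (_ : expR (2 * z) = Q); last by rewrite QE; congr expR; field; lra.
  rewrite /series /= !big_nat_recr //= big_geq // /exp_coeff /= !factS fact0 expr0 expr1.
  rewrite !exprS expr0; lra.
have Q1 : 0 < Q - 1 by nra.
(* The goal with denominators cleared: its right side minus its left side is the difference in [K]
   divided by 2 p z^2 (Q - 1). *)
have K : 4 * z ^+ 3 + 4 * z ^+ 2 + 2 * z < (Q - 1) * (z + 1).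
  apply: (@lt_le_trans _ _ ((2 * z + 2 * z ^+ 2 + 4 / 3 * z ^+ 3) * (z + 1))).
    rewrite -subr_gt0 (_ : _ - _ = z ^+ 3 * (4 / 3 * z - 2 / 3)); last by field.
    by apply: mulr_gt0; [exact: exprn_gt0 | lra].
  by apply: ler_wpM2r => //; lra.
rewrite -subr_gt0.
rewrite (_ : _ - _ = ((Q - 1) * (z + 1) - (4 * z ^+ 3 + 4 * z ^+ 2 + 2 * z))
   / (2 * p * z ^+ 2 * (Q - 1))).
  rewrite divr_gt0 ?subr_gt0 // !mulr_gt0 ?exprn_gt0 //.
by field; rewrite !gt_eqF.
Qed.

(** * Primitives and the hyperbolic sine kernel *)

Lemma is_derive_continuous (R : realType) (F f : R -> R) :
  (forall x, is_derive x (1 : R) F (f x)) -> continuous F.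
Proof.
by move=> dF x; apply/differentiable_continuous/derivable1_diffP; have [] := dF x.
Qed.

Lemma continuous_Rintegral_derive (R : realType) (F f : R -> R) (a b : R) :
  a <= b -> (forall x, is_derive x (1 : R) F (f x)) -> continuous f ->
  \int[mu]_(x in `[a, b]) f x = F b - F a.
Proof.
move=> + dF cf; rewrite le_eqVlt => /predU1P[->|ab].
  by rewrite set_itv1 Rintegral_set1 subrr.
have cF := is_derive_continuous _ _ _ dF.
rewrite /Rintegral (@continuous_FTC2 _ f F a b) //.
- exact: continuous_subspaceT.
- split; first by move=> x _; have [] := dF x.
  + by apply: cvg_at_right_filter; exact: cF.
  + by apply: cvg_at_left_filter; exact: cF.
- by move=> x _; rewrite derive1E; have [] := dF x.
Qed.

(** The kernel is sinh(m (x - T/2)) / (2 sinh(m T/2)). It solves p'' = m^2 p with equal slopes at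
    both ends, the Euler-Lagrange conditions for minimising the integral under p(T) - p(0) = 1. *)
Lemma optimal_kernel (R : realType) (m T Q : R) :
  0 < m -> 0 < T -> Q = expR (m * T) ->
  exists p dp : R -> R, [/\ forall x : R, is_derive x (1 : R) p (dp x), continuous dp,
    p T - p 0 = 1 &
    \int[mu]_(x in `[0, T])
      (p x ^+ 2 + (dp x - T^-1) ^+ 2 / m ^+ 2)
    = (Q + 1) / (2 * m * (Q - 1)) - (T * m ^+ 2)^-1].
Proof.
move=> m0 T0 QE.
have Q1 : 0 < Q - 1 by rewrite subr_gt0 QE expR_gt1 mulr_gt0.
pose B := (2 * (Q - 1))^-1.
pose e x := expR (m * x); pose e' x := expR (m * (T - x)).
have de x : is_derive x (1 : R) e (m * e x).
  by rewrite /e; apply: is_derive_eq; rewrite /GRing.scale /=; ring.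
have de' x : is_derive x (1 : R) e' (- (m * e' x)).
  by rewrite /e'; apply: is_derive_eq; rewrite /GRing.scale /=; ring.
pose p x := B * (e x - e' x); pose dp x := B * m * (e x + e' x).
have ddp x : is_derive x (1 : R) p (dp x).
  by rewrite /p; apply: is_derive_eq; rewrite /dp /GRing.scale /=; ring.
have ce := is_derive_continuous _ _ _ de; have ce' := is_derive_continuous _ _ _ de'.
have cp := is_derive_continuous _ _ _ ddp.
have cdp : continuous dp.
  by move=> x; apply: cvgM; [exact: cvg_cst|apply: cvgD; [exact: ce|exact: ce']].
have e0 : e 0 = 1 by rewrite /e mulr0 expR0.
have eT : e T = Q by rewrite /e -QE.
have e'0 : e' 0 = Q by rewrite /e' subr0 -QE.
have e'T : e' T = 1 by rewrite /e' subrr mulr0 expR0.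
exists p, dp; split => //.
  by rewrite /p e0 eT e'0 e'T /B; field; rewrite gt_eqF.
(* An explicit primitive: in p^2 + (dp/m)^2 the cross terms [e x * e' x] cancel, and only the
   squares of the two exponentials remain. *)
pose G x := B ^+ 2 / m * (e x * e x - e' x * e' x)
   - 2 / (T * m ^+ 2) * p x + x / (T ^+ 2 * m ^+ 2).
have dG (x : R) : is_derive x (1 : R) G (p x ^+ 2 + (dp x - T^-1) ^+ 2 / m ^+ 2).
  rewrite /G; apply: is_derive_eq; rewrite /GRing.scale /= /p /dp; field.
  by rewrite !gt_eqF.
rewrite (continuous_Rintegral_derive _ G _ 0 T (ltW T0) dG).
- rewrite /G /p e0 eT e'0 e'T /B; field.
  by rewrite !gt_eqF.
- move=> x; apply: cvgD; first by apply: cvgM; exact: cp.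
  apply: cvgM; last exact: cvg_cst.
  by apply: cvgM; apply: cvgB; [exact: cdp|exact: cvg_cst|exact: cdp|exact: cvg_cst].
Qed.

(** * Integration by parts from Fubini *)

Lemma measurable_indic_le (R : realType) :
  measurable_fun setT (fun z : R * R => ((z.1 <= z.2)%R%:R : R)).
Proof.
have -> : (fun z : R * R => ((z.1 <= z.2)%R%:R : R)) = \1_[set z : R * R | z.1 <= z.2].
  apply/funext => z; rewrite indicE; congr ((nat_of_bool _)%:R).
  by apply/idP/idP; rewrite inE.
apply/measurable_indicP; rewrite -[X in measurable X]setTI.
exact: measurable_fun_le.
Qed.

Lemma integrable_patch (R : realType) (f : R -> R) (A : set R) :
  measurable (A : set (measurableTypeR R)) -> mu.-integrable A (EFin \o f) ->
  mu.-integrable setT (EFin \o (f \_ A)).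
Proof. by move=> mA fi; rewrite -restrict_EFin; apply/(integrable_mkcond _ mA). Qed.

Lemma integral_patch (R : realType) (f : R -> R) (A : set R) :
  measurable (A : set (measurableTypeR R)) -> mu.-integrable A (EFin \o f) ->
  (\int[mu]_x ((f \_ A) x)%:E)%E = (\int[mu]_(x in A) f x)%:E.
Proof.
move=> mA fi; rewrite /Rintegral fineK ?integrable_fin_num//.
by rewrite [RHS]integral_mkcond restrict_EFin.
Qed.

(** Both sides integrate g(x) f(y) over the triangle 0 <= x <= y <= T, in the two orders. Mere
    integrability suffices, as a weak derivative requires. *)
Lemma absolutely_continuous_by_parts (R : realType) (T : R) (f g : R -> R) :
  0 <= T ->
  mu.-integrable `[0, T] (EFin \o f) -> mu.-integrable `[0, T] (EFin \o g) ->
  \int[mu]_(y in `[0, T]) (f y * \int[mu]_(x in `[0, y]) g x) =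
  \int[mu]_(x in `[0, T])
    (g x * (\int[mu]_(y in `[0, T]) f y - \int[mu]_(y in `[0, x]) f y)).
Proof.
move=> T0 fi gi.
set I := `[0, T]%classic.
have mI : measurable (I : set (measurableTypeR R)) by exact: measurable_itv.
(* Extension by zero outside the square puts Fubini on the whole plane; the last factor cuts out the
   triangle. *)
pose h (z : R * R) := ((g \_ I) z.1 * (f \_ I) z.2 * (z.1 <= z.2)%R%:R)%R.
have gi' : mu.-integrable setT (EFin \o (g \_ I)) by exact: integrable_patch.
have fi' : mu.-integrable setT (EFin \o (f \_ I)) by exact: integrable_patch.
have mg : measurable_fun [set: R] (g \_ I).
  by apply/measurable_EFinP; exact: measurable_int gi'.
have mf : measurable_fun setT (f \_ I).
  by apply/measurable_EFinP; exact: measurable_int fi'.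
have mh : measurable_fun setT h.
  apply: measurable_funM; last exact: measurable_indic_le.
  by apply: measurable_funM; [apply: measurableT_comp mg _|apply: measurableT_comp mf _].
(* By Tonelli, since |h(x, y)| <= |g(x)| |f(y)|. *)
have ih : (mu \x mu)%E.-integrable setT (EFin \o h).
  apply/integrable12ltyP; first exact/measurable_EFinP.
  have [c cE] : exists c : R, (\int[mu]_y `|(f \_ I) y|%:E = c%:E)%E.
    exists (\int[mu]_y `|(f \_ I) y|); rewrite /Rintegral fineK //.
    by apply: integrable_fin_num => //; exact: integrable_norm.
  apply: (@le_lt_trans _ _ (\int[mu]_x (c%:E * `|(g \_ I) x|%:E))%E); last first.
    rewrite integralZl //; last exact: integrable_norm.
    rewrite ltey_eq fin_numM //.
    by apply: integrable_fin_num => //; exact: integrable_norm.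
  apply: ge0_le_integral => //.
  - by move=> x _; exact: integral_ge0.
  - apply: (@measurable_fun_fubini_tonelli_F _ _ _ _ _ mu (fun z => `|(h z)%:E|%E)) => //.
    by apply/measurable_EFinP; exact: measurableT_comp.
  - by apply: emeasurable_funM => //; apply/measurable_EFinP; exact: measurableT_comp.
  move=> x _; rewrite -cE muleC -ge0_integralZl //; last first.
    by apply/measurable_EFinP; exact: measurableT_comp.
  apply: ge0_le_integral => //.
  - apply/measurable_EFinP; apply: measurableT_comp => //.
    by apply: measurableT_comp mh _; exact: pair1_measurable.
  - by apply: measurable_funeM; apply/measurable_EFinP; exact: measurableT_comp.
  move=> y _; rewrite lee_fin /h /= !normrM ler_piMr ?mulr_ge0 //.
  by case: (x <= y); rewrite ?normr1 ?normr0.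
have innerx x : (\int[mu]_y (h (x, y))%:E)%E =
    ((g \_ I) x * (\int[mu]_(y in I) f y - \int[mu]_(y in `[0, x]) f y))%:E.
  have [xI|xI] := boolP (x \in I); last first.
    rewrite integral0_eq ?patchE ?(negbTE xI) ?mul0r // => y _.
    by rewrite /h /= patchE (negbTE xI) !mul0r.
  have /andP[x0 xT] : 0 <= x <= T by have := set_mem xI; rewrite /I /= in_itv.
  have fx : mu.-integrable `[x, T] (EFin \o f).
    by apply: (integrableS mI _ _ fi) => //; apply: subset_itvr; rewrite bnd_simp.
  (* The difference is the integral over ]x, T]; adding the null set {x} matches the weak inequality
     in [h]. *)
  rewrite Rintegral_itvB ?bnd_simp // Rintegral_itv_obnd_cbnd; last first.
    by apply: (integrableS mI _ _ fi) => //; apply: subset_itvr; rewrite bnd_simp.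
  rewrite patchE xI EFinM -integral_patch // -integralZl //; last first.
    exact: integrable_patch.
  apply: eq_integral => y _; rewrite /h /= patchE xI -EFinM -mulrA; congr ((_ * _)%:E).
  rewrite !patchE !mem_setE !in_itv /=.
  by case: (leP x y) => [xy|yx]; rewrite ?(le_trans x0 xy) ?mulr1 ?mulr0.
have innery y : (\int[mu]_x (h (x, y))%:E)%E =
    ((f \_ I) y * \int[mu]_(x in `[0, y]) g x)%:E.
  have [yI|yI] := boolP (y \in I); last first.
    rewrite integral0_eq ?patchE ?(negbTE yI) ?mul0r // => x _.
    by rewrite /h /= !patchE (negbTE yI) mulr0 mul0r.
  have /andP[y0 yT] : 0 <= y <= T by have := set_mem yI; rewrite /I /= in_itv.
  have gy : mu.-integrable `[0, y] (EFin \o g).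
    by apply: (integrableS mI _ _ gi) => //; apply: subset_itvl; rewrite bnd_simp.
  rewrite patchE yI EFinM -integral_patch // -integralZl //; last first.
    exact: integrable_patch.
  apply: eq_integral => x _; rewrite /h /= [(f \_ I) y]patchE yI -EFinM mulrAC mulrC.
  congr ((_ * _)%:E).
  rewrite !patchE !mem_setE !in_itv /=.
  by case: (leP x y) => [xy|yx]; rewrite ?(le_trans xy yT) ?andbT ?andbF ?mulr1 ?mulr0.
rewrite [LHS]Rintegral_mkcond [RHS]Rintegral_mkcond /Rintegral; congr fine.
transitivity (\int[mu]_y \int[mu]_x (h (x, y))%:E)%E.
  by apply: eq_integral => y _; rewrite innery !patchE; case: ifP => // _; rewrite mul0r.
transitivity (\int[mu]_x \int[mu]_y (h (x, y))%:E)%E.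
  exact: esym (@Fubini _ _ _ _ R mu mu _ ih).
by apply: eq_integral => x _; rewrite innerx !patchE; case: ifP => // _; rewrite mul0r.
Qed.

(** * Cauchy-Schwarz and the bound at 0 *)

(** Cauchy-Schwarz in discriminant form. For C > 0 the minimiser al = u / C suffices; for C = 0 and
    u nonzero, al = (N + 1) / (2 u) gives the value -1. *)
Lemma sqr_le_of_quadratic_ge0 (R : realType) (u N C : R) :
  0 <= C -> (forall al, 0 <= N - 2 * al * u + al ^+ 2 * C) -> u ^+ 2 <= C * N.
Proof.
rewrite le_eqVlt => /predU1P[<-|C0] H.
  have [->|u0] := eqVneq u 0; first by rewrite mul0r expr0n.
  have := H ((N + 1) / (2 * u)).
  rewrite (_ : _ + _ = -1); first by rewrite ler0N1.
  by field.
have := H (u / C).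
rewrite (_ : _ + _ = N - u ^+ 2 / C); last by field; rewrite gt_eqF.
by rewrite subr_ge0 ler_pdivrMr // mulrC.
Qed.

(** The interval has finite length and |g| <= 1 + g^2. *)
Lemma L2per_integrable (R : realType) (g : R -> R) :
  L2per g -> mu.-integrable (per_int R) (EFin \o g).
Proof.
move=> [mg ig2].
have mI : measurable (per_int R : set (measurableTypeR R)) by exact: measurable_itv.
apply: (@le_integrable _ _ _ _ _ mI _ (EFin \o (fun x => 1 + g x ^+ 2))).
- exact/measurable_EFinP.
- move=> x _; rewrite lee_fin [leRHS]ger0_norm ?addr_ge0 ?sqr_ge0 //.
  rewrite ler_norml; apply/andP; split; nra.
- apply: (integrableD mI (f := EFin \o cst 1) (g := fun x => (g x ^+ 2)%:E)) => //.
  apply: continuous_compact_integrable; first exact: segment_compact.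
  by move=> x; exact: cvg_cst.
Qed.

(** Real-valued form of the bound, with the integral from [optimal_kernel] at T = 2 pi as its
    constant; it is later summed over real and imaginary parts. *)
Lemma trace_ineq (R : realType) (m Q : R) (u g : R -> R) :
  0 < m -> Q = expR (m * (2 * pi)) -> H1per_deriv u g -> mean_int u = 0 ->
  u 0 ^+ 2 <= ((Q + 1) / (2 * m * (Q - 1)) - (2 * pi * m ^+ 2)^-1) *
              (sq_norm g + m ^+ 2 * sq_norm u).
Proof.
move=> m0 QE [uper [Lg ug]] mean0.
have T0 : 0 < 2 * pi :> R by rewrite mulr_gt0 ?pi_gt0.
have [p [dp [ddp cdp pT <-]]] := @optimal_kernel R m (2 * pi) Q m0 T0 QE.
set k := (2 * pi)^-1.
(* [W] equals [u] on the period interval and is continuous there as a primitive, hence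
   integrable. *)
pose W x := u 0 + \int[mu]_(t in `[0, x]) g t.
have uW : {in per_int R, u =1 W}.
  by move=> x xI; apply: ug; have := set_mem xI; rewrite /per_int /= in_itv.
have mI : measurable (per_int R : set (measurableTypeR R)) by exact: measurable_itv.
have iZ (c : R) (f : R -> R) : mu.-integrable (per_int R) (EFin \o f) ->
    mu.-integrable (per_int R) (EFin \o (fun x => c * f x)).
  by move=> fi; exact: (integrableZl mI c fi).
have iD (f h : R -> R) : mu.-integrable (per_int R) (EFin \o f) ->
    mu.-integrable (per_int R) (EFin \o h) ->
    mu.-integrable (per_int R) (EFin \o (fun x => f x + h x)).
  by move=> fi hi; exact: (integrableD mI fi hi).
have iB (f h : R -> R) : mu.-integrable (per_int R) (EFin \o f) ->
    mu.-integrable (per_int R) (EFin \o h) ->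
    mu.-integrable (per_int R) (EFin \o (fun x => f x - h x)).
  by move=> fi hi; exact: (integrableB mI fi hi).
have ig := L2per_integrable _ _ Lg.
have [mg ig2] := Lg.
have cW : {within per_int R, continuous W}.
  have cJ := @parameterized_integral_continuous R 0 (2 * pi) g (ltW T0) ig.
  by move=> x; apply: cvgD; [exact: cvg_cst|exact: cJ].
have cp := is_derive_continuous _ _ _ ddp.
have cI (f : R -> R) : {within per_int R, continuous f} ->
    mu.-integrable (per_int R) (EFin \o f).
  by move=> cf; apply: continuous_compact_integrable => //; exact: segment_compact.
have cpI : {within per_int R, continuous p} by exact: continuous_subspaceT.
have cdpI : {within per_int R, continuous dp} by exact: continuous_subspaceT.
(* Periodicity enters here, through u(2 pi) = u(0). *)
have intg0 : \int[mu]_(x in per_int R) g x = 0.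
  have := uper 0; rewrite add0r ug; last by rewrite lexx (ltW T0).
  move=> H; apply: (@addrI _ (u 0)); rewrite addr0; exact: H.
have igp : mu.-integrable (per_int R) (EFin \o (fun x => g x * p x)).
  apply: (@le_integrable _ _ _ _ _ mI _ (EFin \o (fun x => g x ^+ 2 + p x ^+ 2))).
  - apply/measurable_EFinP; apply: measurable_funM => //.
    by have /measurable_int/measurable_EFinP := cI _ cpI.
  - move=> x _; rewrite lee_fin [leRHS]ger0_norm ?addr_ge0 ?sqr_ge0 //.
    have := sqr_ge0 (g x - p x); have := sqr_ge0 (g x + p x).
    rewrite ler_norml => H1 H2; apply/andP; split; nra.
  - apply: (integrableD mI (f := fun x => (g x ^+ 2)%:E)
      (g := EFin \o (fun x => p x ^+ 2))) => //.
    by apply: cI => x; apply: cvgM; exact: cpI.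
have iWdp : mu.-integrable (per_int R) (EFin \o (fun x => dp x * W x)).
  by apply: cI => x; apply: cvgM; [exact: cdpI|exact: cW].
have iW := cI _ cW.
have idp := cI _ cdpI.
have intW0 : \int[mu]_(x in per_int R) W x = 0.
  by rewrite -mean0; apply/esym/eq_Rintegral.
(* The boundary term of the integration by parts is u(0) (p(2 pi) - p(0)) = u(0). *)
have u0E : \int[mu]_(x in per_int R) (g x * p x) +
    \int[mu]_(x in per_int R) (dp x * W x) = u 0.
  have FTC y : 0 <= y -> \int[mu]_(x in `[0, y]) dp x = p y - p 0.
    by move=> y0; exact: continuous_Rintegral_derive.
  have := @absolutely_continuous_by_parts R (2 * pi) dp g (ltW T0) idp ig.
  rewrite FTC ?(ltW T0) //.
  have -> : \int[mu]_(y in per_int R) (dp y * W y) =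
      u 0 + \int[mu]_(y in `[0, 2 * pi]) (dp y * \int[mu]_(x in `[0, y]) g x).
    rewrite (@eq_Rintegral _ _ _ mu `[0, 2 * pi]
      (fun y => dp y * W y - u 0 * dp y)); last first.
      by move=> y _; rewrite /W; ring.
    rewrite RintegralB ?RintegralZl //; last exact: iZ.
    by rewrite FTC ?(ltW T0) // pT; ring.
  move=> ->.
  rewrite (@eq_Rintegral _ _ _ mu `[0, 2 * pi] (fun x => p (2 * pi) * g x - g x * p x)
    (fun x => g x * (p (2 * pi) - p 0 - \int[mu]_(y in `[0, x]) dp y))); last first.
    move=> x /set_mem; rewrite /= in_itv /= => /andP[x0 _].
    by rewrite FTC //; ring.
  rewrite RintegralB ?RintegralZl //; last exact: iZ.
  by rewrite intg0; ring.
have iW2 : mu.-integrable (per_int R) (EFin \o (fun x => W x ^+ 2)).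
  by apply: cI => x; apply: cvgM; exact: cW.
apply: sqr_le_of_quadratic_ge0.
  by apply: Rintegral_ge0 => x _; rewrite addr_ge0 ?divr_ge0 ?sqr_ge0.
move=> al.
(* The quadratic in [al] is the integral of A - 2 al B + al^2 C, whose integrand is a sum of two
   squares. The [k * W] in [B] integrates to 0 by the zero mean. *)
pose A x := g x ^+ 2 + m ^+ 2 * W x ^+ 2.
pose B x := g x * p x + dp x * W x - k * W x.
pose C x := p x ^+ 2 + (dp x - k) ^+ 2 / m ^+ 2.
have iAx : mu.-integrable (per_int R) (EFin \o A).
  by apply: iD => //; exact: iZ.
have iBx : mu.-integrable (per_int R) (EFin \o B).
  by apply: iB => //; [exact: iD|exact: iZ].
have iCx : mu.-integrable (per_int R) (EFin \o C).
  apply: cI => x; apply: cvgD; first by apply: cvgM; exact: cpI.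
  apply: cvgM; last exact: cvg_cst.
  by apply: cvgM; apply: cvgB; [exact: cdpI|exact: cvg_cst|exact: cdpI|exact: cvg_cst].
have -> : sq_norm g + m ^+ 2 * sq_norm u = \int[mu]_(x in per_int R) A x.
  rewrite RintegralD ?RintegralZl //; last exact: iZ.
  by congr (_ + _ * _); apply: eq_Rintegral => x xI; rewrite uW.
have -> : u 0 = \int[mu]_(x in per_int R) B x.
  rewrite RintegralB; [|by []|exact: iD|exact: iZ].
  by rewrite RintegralD // RintegralZl // u0E intW0 mulr0 subr0.
rewrite -!RintegralZl // -RintegralB //; last exact: iZ.
rewrite -RintegralD //; [|by apply: iB => //; exact: iZ|exact: iZ].
apply: Rintegral_ge0 => x _.
rewrite [leRHS](_ : _ = (g x - al * p x) ^+ 2 + (m * W x - al / m * (dp x - k)) ^+ 2).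
  by rewrite addr_ge0 ?sqr_ge0.
by rewrite /A /B /C; field; rewrite gt_eqF.
Qed.

Theorem theorem2p4 (R : realType) (D : R) (hD : 1 <= D) :
  VV D < Num.sqrt D - pi^-1.
Proof.
have p2 := pi_ge2 R; have p0 : 0 < pi :> R by exact: pi_gt0.
have s1 : 1 <= Num.sqrt D by rewrite -[leLHS]sqrtr1 ler_wsqrtr.
set s := Num.sqrt D.
have sD : s ^+ 2 = D by rewrite sqr_sqrtr // (le_trans ler01).
have pV : pi^-1 < 1 :> R by rewrite invf_lt1 //; apply: lt_le_trans p2; rewrite ltr1n.
(* The supremum of the empty set is 0 by convention, and 1/pi < 1 <= sqrt D covers this case. *)
rewrite /VV; have [->|/set0P V0] := eqVneq (Vset D) set0.
  by rewrite sup0 subr_gt0 (lt_le_trans pV).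
(* z = pi m for the choice m = sqrt D - 1/pi; it is at least 1 because pi >= 2. *)
pose z := pi * s - 1 : R.
have z1 : 1 <= z by rewrite /z lerBrDr -[leLHS]mulr1 ler_pM.
have sE : s = (z + 1) / pi by rewrite /z subrK mulrAC divff ?mul1r // gt_eqF.
have m0 : 0 < z / pi by rewrite divr_gt0 // (lt_le_trans ltr01).
(* Strictness lies between two constants, so it survives the passage to the supremum. *)
apply: le_lt_trans (@optimal_constant_lt R pi s z _ p0 z1 sE erefl).
apply: ge_sup => // _ [a [b [ga [gb [[ha hb] [ma mb] n1 nD ->]]]]].
have Ha := trace_ineq R (z / pi) _ _ _ m0 erefl ha ma.
have Hb := trace_ineq R (z / pi) _ _ _ m0 erefl hb mb.
by apply: le_trans (lerD Ha Hb) _; rewrite -mulrDr addrACA nD -mulrDr n1 mulr1 sD.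
Qed.
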